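(* Let $S$ be a sampling with replacement consisting of $\tau$ independent draws from a distribution on $[n]$ with probabilities $\tilde p_i>0$. Let each $f_i:\mathbb{R}^d\to\mathbb{R}$ be $L_i$-smooth and convex, and let $f=\frac1n\sum_{i=1}^nf_i$ be $L_f$-smooth and convex. Then the expected smoothness constant $\mathcal{L}_1$ (defined in the context) satisfies $$\mathcal{L}_1\le\left(1-\frac1\tau\right)L_f+\frac{1}{n\tau}\max_{i\in[n]}\frac{L_i}{\tilde p_i}.$$
   Context: $[n]=\{1,\dots,n\}$; $e\in\mathbb{R}^n$ is the all-ones vector. $\psi:\mathbb{R}^d\to\mathbb{R}\cup\{+\infty\}$ is proper closed convex; $x^*$ is a fixed global minimizer of $P=f+\psi$ (assumed to exist). $L$-smooth means differentiable with $L$-Lipschitz gradient. Sampling with replacement: $S$ is the multiset of $\tau\ge1$ independent indices, each equal to $i$ with probability $\tilde p_i$. Weights: $\theta_S^i=1/(\tau\tilde p_i)$; $\theta_S$ is the diagonal matrix with these entries; $\mathbf{I}_S$ is the diagonal matrix whose $i$-th entry is the number of copies of $i$ in $S$; $\mathbf{G}(x)=[\nabla f_1(x),\dots,\nabla f_n(x)]$. Thus $\frac1n\mathbf{G}(x)\theta_S\mathbf{I}_Se=\frac1n\sum_{i\in S}\frac{1}{\tau\tilde p_i}\nabla f_i(x)$ with multiplicities. $\mathcal{L}_1$ is the smallest constant $\ge0$ such that for all $x\in\mathbb{R}^d$: $\mathbb{E}\left[\|\frac1n(\mathbf{G}(x)-\mathbf{G}(x^* ))\theta_S\mathbf{I}_Se\|^2\right]\le2\mathcal{L}_1(f(x)-f(x^*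 )-\langle\nabla f(x^* ),x-x^*\rangle)$. *)

(* Defs.v *)
From HB Require Import structures.
From mathcomp Require Import all_boot all_order all_algebra.
From mathcomp Require Import all_classical all_reals all_analysis.

Set Implicit Arguments.
Unset Strict Implicit.
Unset Printing Implicit Defensive.

Import Order.TTheory GRing.Theory Num.Theory.
Import numFieldNormedType.Exports.

Local Open Scope classical_set_scope.
Local Open Scope ring_scope.

Section Euclidean.
Context {R : realType} {d : nat}.
Implicit Types (u v x y : 'cV[R]_d) (g : 'cV[R]_d -> R).

Definition dot u v : R := (u^T *m v) ord0 ord0.

(* The norm `|_| of the library on matrices is the sup norm. It induces the
   same topology, hence the same differentiability, but not the same Lipschitz
   constants. *)
Definition enorm u : R := Num.sqrt (dot u u).

Definition gradient g x : 'cV[R]_d := \col_i 'D_(delta_mx i ord0) g x.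

(* [0 <= L] is implied by the other clauses except when d = 0. *)
Definition L_smooth (L : R) g : Prop :=
  [/\ 0 <= L,
      forall x, differentiable g x &
      forall x y, enorm (gradient g x - gradient g y) <= L * enorm (x - y)].

Definition convex g : Prop :=
  convex_function (setT : set (convex_lmodType 'cV[R]_d)) g.

End Euclidean.

Section ExtendedValued.
Context {R : realType} {d : nat}.
Implicit Type psi : 'cV[R]_d -> \bar R.

Definition epigraph psi : set ('cV[R]_d * R^o) :=
  [set xr | (psi xr.1 <= (xr.2 : R)%:E)%E].

(* The first clause restricts the values to R U {+oo}. *)
Definition proper psi : Prop :=
  (forall x, psi x != -oo%E) /\ (exists x, (psi x < +oo)%E).

Definition proper_closed_convex psi : Prop :=
  [/\ proper psi,
      closed (epigraph psi) &
      convex_set (epigraph psi : set (convex_lmodType ('cV[R]_d * R^o)%type))].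

Definition is_minimizer (f : 'cV[R]_d -> R) psi (xs : 'cV[R]_d) : Prop :=
  (forall x, ((f xs)%:E + psi xs <= (f x)%:E + psi x)%E).

End ExtendedValued.

Section Sampling.
Context {R : realType} {disp : measure_display} {Omega : measurableType disp}.
Context {n tau : nat}.
Variable P : probability Omega R.
Implicit Types (S : 'I_tau -> Omega -> 'I_n) (p : 'I_n -> R).

Definition mutually_independent S : Prop :=
  forall (J : {set 'I_tau}) (A : 'I_tau -> set 'I_n),
    P (\bigcap_(k in [set` J]) (S k @^-1` A k)) =
    (\prod_(k in J) P (S k @^-1` A k))%E.

(* The multiset is represented by its draws S 0, ..., S (tau - 1), which are
   random variables with values in the discrete space 'I_n. *)
Definition sampling_with_replacement p S : Prop :=
  [/\ forall k (A : set 'I_n), measurable (S k @^-1` A),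
      mutually_independent S &
      forall k i, P (S k @^-1` [set i]) = (p i)%:E].

End Sampling.

Section ExpectedSmoothness.
Context {R : realType} {disp : measure_display} {Omega : measurableType disp}.
Context {n tau d : nat}.
Variables (P : probability Omega R) (p : 'I_n -> R).
Variables (S : 'I_tau -> Omega -> 'I_n) (fs : 'I_n -> 'cV[R]_d -> R).

Definition average (x : 'cV[R]_d) : R := n%:R^-1 * \sum_i fs i x.

Definition G (x : 'cV[R]_d) : 'M[R]_(d, n) :=
  \matrix_(j, i) gradient (fs i) x j ord0.

Definition theta : 'M[R]_n := diag_mx (\row_i (tau%:R * p i)^-1).

Definition I_S (w : Omega) : 'M[R]_n :=
  diag_mx (\row_i #|[set k | S k w == i]%SET|%:R).

Definition sketched_gradient_diff (x xs : 'cV[R]_d) (w : Omega) : 'cV[R]_d :=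
  n%:R^-1 *: ((G x - G xs) *m theta *m I_S w *m const_mx 1).

Definition expected_smoothness (xs : 'cV[R]_d) (L : R) : Prop :=
  0 <= L /\
  forall x : 'cV[R]_d,
    ('E_P[fun w => (enorm (sketched_gradient_diff x xs w) ^+ 2)%R] <=
     (2 * L * (average x - average xs
               - dot (gradient average xs) (x - xs)))%R%:E)%E.

Definition is_expected_smoothness_constant (xs : 'cV[R]_d) (L1 : R) : Prop :=
  expected_smoothness xs L1 /\
  forall L, expected_smoothness xs L -> L1 <= L.

End ExpectedSmoothness.

(* Main.v *)
Require Import Defs.
From HB Require Import structures.
From mathcomp Require Import all_boot all_order all_algebra.
From mathcomp Require Import all_classical all_reals all_analysis.
From mathcomp Require Import ring lra.

Set Implicit Arguments.
Unset Strict Implicit.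
Unset Printing Implicit Defensive.

Import Order.TTheory GRing.Theory Num.Theory.
Import numFieldNormedType.Exports.

Local Open Scope classical_set_scope.
Local Open Scope ring_scope.

(** Write D_i and D for the Bregman gaps g(x) - g(y) - <grad g(y), x - y> of
f_i and of the average f, taken between x and the base point y (the minimizer);
D is the average of the D_i. Two facts carry the proof.

Smoothness and convexity of g give |grad g(x) - grad g(y)|^2 <= 2 L D_g(x, y)
([sqr_gradient_le_bregman]): g - <grad g(y), .> is minimal at y, and a gradient
step of length 1/L from x decreases it by at least |grad g(x) - grad g(y)|^2 /
(2 L), by the descent lemma ([descent_le]).

The sketched gradient difference is a sum of tau independent, identically
distributed terms a(S_k), with a_i = (grad f_i(x) - grad f_i(y)) / (n tau p_i).
Expanding the square, the diagonal pairs of draws contribute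
tau * sum_i p_i |a_i|^2 and the tau (tau - 1) other pairs |sum_i p_i a_i|^2
each ([expectation_sqr_sum_draws]). Since
sum_i p_i a_i = (grad f(x) - grad f(y)) / tau, the second moment equals
  1/(n^2 tau) sum_i |grad f_i(x) - grad f_i(y)|^2 / p_i
    + (1 - 1/tau) |grad f(x) - grad f(y)|^2
([expectation_sketched_gradient_diff]). The first fact, applied to each f_i
and to f, bounds this by 2 C D, where C is the announced bound
([sketch_second_moment_le]). So C is an admissible constant; as the admissible
constants form a closed set of nonnegative numbers, there is a least one
([ex_least_multiplier]), and it is at most C. *)

(** * The Euclidean inner product *)

Section DotProduct.
Context {R : realType} {d : nat}.
Implicit Types u v w x y : 'cV[R]_d.

Lemma dotE u v : dot u v = \sum_j u j ord0 * v j ord0.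
Proof. by rewrite /dot mxE; apply: eq_bigr => j _; rewrite mxE. Qed.

Lemma dotC u v : dot u v = dot v u.
Proof. by rewrite !dotE; apply: eq_bigr => j _; rewrite mulrC. Qed.

Lemma dotDl u v w : dot (u + v) w = dot u w + dot v w.
Proof. by rewrite /dot linearD mulmxDl mxE. Qed.

Lemma dotZl a u v : dot (a *: u) v = a * dot u v.
Proof. by rewrite /dot linearZ -scalemxAl mxE. Qed.

Lemma dotNl u v : dot (- u) v = - dot u v.
Proof. by rewrite -scaleN1r dotZl mulN1r. Qed.

Lemma dotDr u v w : dot w (u + v) = dot w u + dot w v.
Proof. by rewrite dotC dotDl !(dotC w). Qed.

Lemma dotZr a u v : dot u (a *: v) = a * dot u v.
Proof. by rewrite dotC dotZl dotC. Qed.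

Lemma dotNr u v : dot u (- v) = - dot u v.
Proof. by rewrite dotC dotNl dotC. Qed.

Lemma dot0l v : dot 0 v = 0.
Proof. by rewrite /dot trmx0 mul0mx mxE. Qed.

Lemma dot_suml (I : finType) (F : I -> 'cV[R]_d) v :
  dot (\sum_i F i) v = \sum_i dot (F i) v.
Proof.
exact: (big_morph (dot^~ v) (fun u w => dotDl u w v) (dot0l v)).
Qed.

Lemma dot_sumr (I : finType) (F : I -> 'cV[R]_d) v :
  dot v (\sum_i F i) = \sum_i dot v (F i).
Proof. by rewrite dotC dot_suml; apply: eq_bigr => i _; rewrite dotC. Qed.

Lemma dot_ge0 u : 0 <= dot u u.
Proof. by rewrite dotE; apply: sumr_ge0 => j _; rewrite -expr2 sqr_ge0. Qed.

Lemma dot_eq0 u : dot u u = 0 -> u = 0.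
Proof.
rewrite dotE => /eqP; rewrite psumr_eq0; last first.
  by move=> j _; rewrite -expr2 sqr_ge0.
move=> /allP u0; apply/matrixP => i j; rewrite (ord1 j) mxE.
by have := u0 i (mem_index_enum i); rewrite /= mulf_eq0 orbb => /eqP.
Qed.

Lemma enorm_sqr u : enorm u ^+ 2 = dot u u.
Proof. by rewrite /enorm sqr_sqrtr ?dot_ge0. Qed.

Lemma enorm_ge0 u : 0 <= enorm u.
Proof. exact: sqrtr_ge0. Qed.

Lemma enormZ a u : enorm (a *: u) = `|a| * enorm u.
Proof.
by rewrite /enorm dotZl dotZr mulrA -expr2 sqrtrM ?sqr_ge0 // sqrtr_sqr.
Qed.

(** The Cauchy-Schwarz inequality. *)
Lemma dot_le_enorm u v : dot u v <= enorm u * enorm v.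
Proof.
have [v0|v0] := eqVneq (dot v v) 0.
  by rewrite (dot_eq0 v0) dotC dot0l mulr_ge0 ?enorm_ge0.
have vv : 0 < dot v v by rewrite lt_neqAle eq_sym v0 dot_ge0.
have h : dot u v ^+ 2 <= dot u u * dot v v.
  (* The squared norm of this vector is [dot v v] times the defect. *)
  have := dot_ge0 (dot v v *: u - dot u v *: v).
  rewrite dotDl !dotDr !dotNl !dotNr !dotZl !dotZr (dotC v u) => h.
  rewrite -subr_ge0 -(pmulr_rge0 _ vv).
  by apply: le_trans h _; rewrite le_eqVlt; apply/orP; left; apply/eqP; ring.
apply: le_trans (ler_norm _) _.
rewrite -sqrtr_sqr /enorm -sqrtrM ?dot_ge0 //.
exact: ler_wsqrtr.
Qed.

End DotProduct.

(** * Gradients and Bregman gaps of smooth convex functions *)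

Section Gradient.
Context {R : realType} {d : nat}.
Implicit Types (u v w x y : 'cV[R]_d) (g : 'cV[R]_d -> R).

Lemma derive_gradient g x v :
  differentiable g x -> 'D_v g x = dot (gradient g x) v.
Proof.
move=> dg; rewrite deriveE //.
have -> : v = \sum_i v i ord0 *: delta_mx i ord0.
  by rewrite [LHS]matrix_sum_delta; apply: eq_bigr => i _; rewrite big_ord1.
rewrite linear_sum dot_sumr; apply: eq_bigr => i _.
rewrite linearZ dotZr /= -deriveE //; congr (_ * _).
rewrite dotE (bigD1 i) //= big1 => [|j ji]; rewrite !mxE.
  by rewrite !eqxx mulr1 addr0.
by rewrite (negbTE ji) /= mulr0.
Qed.

Lemma is_derive_line g x v (t : R) : differentiable g (x + t *: v) ->
  is_derive t 1 (fun s : R => g (x + s *: v))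
    (dot (gradient g (x + t *: v)) v).
Proof.
move=> dg.
have dl : is_diff t (fun s : R => x + s *: v) (fun s : R => s *: v).
  by apply: is_diff_eq; rewrite add0r.
have dgl : differentiable (g \o (fun s : R => x + s *: v)) t.
  by apply: differentiable_comp.
apply: DeriveDef; first exact: diff_derivable.
rewrite (deriveE _ dgl) diff_comp //= diff_val scale1r -deriveE //.
exact: derive_gradient.
Qed.

End Gradient.

Section Convexity.
Context {R : realType} {d : nat}.
Implicit Types (u v w x y : 'cV[R]_d) (g : 'cV[R]_d -> R).

(** The gap between [g x] and the affine approximation of [g] at [y]. *)
Definition bregman g x y : R := g x - g y - dot (gradient g y) (x - y).

Lemma convex_le g x y (t : R) : convex g -> 0 <= t -> t <= 1 ->
  g (t *: x + (1 - t) *: y) <= t * g x + (1 - t) * g y.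
Proof.
move=> cg t0 t1; have it : t \in `[0, 1] by rewrite in_itv /= t0.
exact: (cg (Itv01 t0 t1) x y (mem_setT _) (mem_setT _)).
Qed.

(** A convex function lies above its tangent hyperplanes. *)
Lemma bregman_ge0 g x y :
  convex g -> differentiable g y -> 0 <= bregman g x y.
Proof.
move=> cg dg; rewrite /bregman subr_ge0 -derive_gradient //.
have /cvg_dnbhs_at_right cD :
  (fun h : R => h^-1 *: (g (h *: (x - y) + y) - g y)) @ 0^'
    --> 'D_(x - y) g y by apply: diff_derivable.
(* The difference quotient at [h] in ]0, 1] is at most [g x - g y]. *)
rewrite -(cvg_lim _ cD) //; apply: limr_le.
  by apply/cvg_ex; eexists; exact: cD.
near=> h.
have h0 : 0 < h by near: h; exact: nbhs_right_gt.
have h1 : h <= 1 by near: h; exact: nbhs_right_le.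
have := convex_le x y cg (ltW h0) h1.
have -> : h *: x + (1 - h) *: y = h *: (x - y) + y.
  by apply/matrixP => i j; rewrite !mxE; ring.
move=> hc; rewrite -ler_pdivlMl ?invr_gt0 // invrK; lra.
Unshelve. all: by end_near.
Qed.

(** The descent lemma. *)
Lemma descent_le (L : R) g x v : L_smooth L g ->
  g (x + v) <= g x + dot (gradient g x) v + L / 2 * dot v v.
Proof.
move=> [L0 dg lip].
(* Along the segment from [x] to [x + v], [psi] is [g] minus the quadratic upper
   bound, up to a constant. Its derivative is [<= 0] on [0, 1], and the mean
   value theorem compares its values at the endpoints. *)
pose c := dot (gradient g x) v; pose q := L / 2 * dot v v.
pose phi (s : R) := g (x + s *: v).
pose psi : R -> R := phi - c \*: (id : R -> R) - q \*: ((id : R -> R) ^+ 2).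
pose dpsi (s : R) := dot (gradient g (x + s *: v)) v - c - q * (2 * s).
have psiE s : psi s = g (x + s *: v) - c * s - q * s ^+ 2 by [].
have dpsiP (s : R) : is_derive s 1 psi (dpsi s).
  have dphi := is_derive_line (dg (x + s *: v)).
  apply: is_derive_eq.
  rewrite /dpsi /GRing.scale /= expr1 mulr1; congr (_ - _ - _ * _); ring.
have [s] := @MVT R psi dpsi 0 1 ltr01 (fun s _ => dpsiP s)
  (derivable_within_continuous (fun s _ => @ex_derive _ _ _ _ _ _ _ (dpsiP s))).
rewrite in_itv /= => /andP[s0 _].
rewrite subr0 mulr1 !psiE scale1r scale0r addr0 => psi01.
suff : dpsi s <= 0 by rewrite -psi01 -/c -/q => h; lra.
have := le_trans (dot_le_enorm (gradient g (x + s *: v) - gradient g x) v)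
  (ler_wpM2r (enorm_ge0 v) (lip (x + s *: v) x)).
rewrite (_ : x + s *: v - x = s *: v); last by rewrite addrC addKr.
rewrite enormZ gtr0_norm // dotDl dotNl.
have -> : L * (s * enorm v) * enorm v = L * s * dot v v.
  by rewrite -enorm_sqr; ring.
rewrite /dpsi -/c /q => h; lra.
Qed.

(** A gradient step of length [L^-1] from [x], for [g] minus its linearization
at [y], cannot go below the minimal value of that difference, reached at [y].
For [L = 0] the gradient is constant. *)
Lemma sqr_gradient_le_bregman (L : R) g x y : L_smooth L g -> convex g ->
  enorm (gradient g x - gradient g y) ^+ 2 <= 2 * L * bregman g x y.
Proof.
move=> gs cg; have [L0 dg lip] := gs; rewrite enorm_sqr.
set w := gradient g x - gradient g y.
have [L00|Ln0] := eqVneq L 0.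
  have := lip x y; rewrite L00 mul0r mulr0 mul0r -/w => w0.
  have /eqP w00 : enorm w == 0 by rewrite eq_le w0 enorm_ge0.
  by rewrite -enorm_sqr w00 expr0n.
have Lp : 0 < L by rewrite lt_neqAle eq_sym Ln0.
(* The displacement of the gradient step. *)
pose v := - (L^-1 *: w).
have := descent_le x v gs.
have := bregman_ge0 (x + v) cg (dg y).
rewrite /bregman => h1 h2.
have : 0 <= g x - g y - dot (gradient g y) (x - y) + dot w v + L / 2 * dot v v.
  have -> : dot w v = dot (gradient g x) v - dot (gradient g y) v.
    by rewrite /w dotDl dotNl.
  move: h1; rewrite (addrAC x) (dotDr (x - y)) => h1; lra.
rewrite /v !(dotNr, dotNl) opprK !(dotZl, dotZr).
set D := g x - _ - _; set W := dot w w.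
have -> : D + - (L^-1 * W) + L / 2 * (L^-1 * (L^-1 * W)) = D - W / (2 * L).
  by field.
by rewrite subr_ge0 ler_pdivrMr ?mulr_gt0 // mulrC.
Qed.

End Convexity.

Section Average.
Context {R : realType} {d n : nat}.
Implicit Types (x y : 'cV[R]_d) (fs : 'I_n -> 'cV[R]_d -> R).

Lemma gradient_average fs x : (forall i, differentiable (fs i) x) ->
  gradient (average fs) x = n%:R^-1 *: \sum_i gradient (fs i) x.
Proof.
move=> df; apply/matrixP => j k; rewrite !mxE summxE.
have -> : average fs = n%:R^-1 *: \sum_i fs i.
  by apply/funext => y; rewrite /average fctE fct_sumE.
rewrite deriveZ; last by apply: derivable_sum => i; exact: diff_derivable.
rewrite derive_sum; last by move=> i; exact: diff_derivable.
by rewrite /GRing.scale /=; congr (_ * _); apply: eq_bigr => i _; rewrite mxE.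
Qed.

Lemma bregman_average fs x y : (forall i, differentiable (fs i) y) ->
  bregman (average fs) x y = n%:R^-1 * \sum_i bregman (fs i) x y.
Proof.
move=> df; rewrite /bregman gradient_average // dotZl dot_suml /average.
by rewrite !sumrB; ring.
Qed.

End Average.

(** * Second moment of a sum of independent draws *)

Section FiniteRange.
Context {R : realType} {disp : measure_display} {Omega : measurableType disp}.
Variable P : probability Omega R.
Context {T : finType} (X : Omega -> T) (q : T -> R) (h : T -> R).
Hypothesis mX : forall t, measurable (X @^-1` [set t]).
Hypothesis PX : forall t, P (X @^-1` [set t]) = (q t)%:E.

Let decomp w :
  ((h (X w))%:E = \sum_t (h t)%:E * (\1_(X @^-1` [set t]) w)%:E)%E.
Proof.
rewrite (bigD1 (X w)) //= big1 ?adde0 => [|t tX].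
  by rewrite indicE mem_set // mule1.
by rewrite indicE memNset ?mule0 // => /= Xt; rewrite Xt eqxx in tX.
Qed.

Let integrable_term t : P.-integrable setT
  (fun w => (h t)%:E * (\1_(X @^-1` [set t]) w)%:E)%E.
Proof. by apply: integrableZl => //; exact: integrable_indic. Qed.

Lemma integrable_finite_range : P.-integrable setT (fun w => (h (X w))%:E).
Proof.
rewrite (_ : (fun w => _) =
  (fun w => \sum_t (h t)%:E * (\1_(X @^-1` [set t]) w)%:E)%E).
  exact: integrable_sum.
by apply/funext => w; exact: decomp.
Qed.

(** The law of the unconscious statistician, for a finite range. *)
Lemma integral_finite_range :
  (\int[P]_w (h (X w))%:E)%E = (\sum_t h t * q t)%:E.
Proof.
under eq_integral do rewrite decomp.
rewrite integral_sum //= -sumEFin; apply: eq_bigr => t _.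
rewrite integralZl //; last exact: integrable_indic.
rewrite integral_indic // setIT EFinM; congr (_ * _)%E; exact: PX.
Qed.

End FiniteRange.

Section Draws.
Context {R : realType} {disp : measure_display} {Omega : measurableType disp}.
Context {n tau d : nat}.
Variables (P : probability Omega R) (p : 'I_n -> R).
Variable S : 'I_tau -> Omega -> 'I_n.
Hypothesis S_sampling : sampling_with_replacement P p S.

Let draws k l w := (S k w, S l w).

(* The joint law of two draws; the draws of a pair with [k = l] are equal. *)
Let draws_law (k l : 'I_tau) (i j : 'I_n) : R :=
  if k == l then if i == j then p i else 0 else p i * p j.

Let draws_preimage k l ij : draws k l @^-1` [set ij] =
  (S k @^-1` [set ij.1]) `&` (S l @^-1` [set ij.2]).
Proof.
by case: ij => i j; apply/seteqP; split => w; rewrite /draws /= => -[-> ->].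
Qed.

Let measurable_draws k l ij : measurable (draws k l @^-1` [set ij]).
Proof.
by have [mS _ _] := S_sampling; rewrite draws_preimage; exact: measurableI.
Qed.

Let prob_draws k l ij :
  P (draws k l @^-1` [set ij]) = (draws_law k l ij.1 ij.2)%:E.
Proof.
have [mS iS pS] := S_sampling; rewrite draws_preimage /draws_law.
case: ij => i j /=; have [->|kl] := eqVneq k l.
  have [->|ij] := eqVneq i j; first by rewrite setIid pS.
  rewrite (_ : _ `&` _ = set0) ?measure0 //.
  by apply/seteqP; split => // w /= [-> /eqP]; rewrite (negbTE ij).
pose A m : set 'I_n := if m == k then [set i] else [set j].
(* Independence for the subfamily {k, l}. *)
have := iS [set k; l]%SET A.
rewrite big_setU1 ?inE //= big_set1 /A eqxx eq_sym (negbTE kl) !pS EFinM => <-.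
congr (P _); apply/seteqP; split => w /=.
  move=> [Sk Sl] m; rewrite /= !inE => /orP[]/eqP ->; first by rewrite eqxx.
  by rewrite eq_sym (negbTE kl).
move=> H; split.
  by have := H k; rewrite /= !inE !eqxx; apply.
by have := H l; rewrite /= !inE !eqxx orbT eq_sym (negbTE kl); apply.
Qed.

(** In the second moment of a sum of i.i.d. vectors, the [tau] diagonal pairs
contribute the second moment of one vector each, and the [tau * (tau - 1)]
other pairs the squared norm of the mean each. *)
Lemma expectation_sqr_sum_draws (a : 'I_n -> 'cV[R]_d) :
  ('E_P[fun w => (enorm (\sum_k a (S k w)) ^+ 2)%R] =
  (tau%:R * (\sum_i p i * enorm (a i) ^+ 2)
   + tau%:R * (tau%:R - 1) * enorm (\sum_i p i *: a i) ^+ 2)%R%:E)%E.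
Proof.
pose h (ij : 'I_n * 'I_n) := dot (a ij.1) (a ij.2).
have hint k l := integrable_finite_range P h (measurable_draws k l).
rewrite unlock.
under eq_integral => w _.
  rewrite enorm_sqr dot_suml.
  rewrite (eq_bigr (fun k => \sum_l h (draws k l w))); last first.
    by move=> k _; rewrite dot_sumr.
  rewrite pair_big -sumEFin.
  over.
rewrite integral_sum //=.
rewrite (eq_bigr (fun kl : 'I_tau * 'I_tau =>
    (\sum_i \sum_j h (i, j) * draws_law kl.1 kl.2 i j)%:E)); last first.
  move=> kl _.
  rewrite (integral_finite_range h (measurable_draws _ _) (prob_draws _ _)).
  by rewrite pair_big; congr (_%:E); apply: eq_bigr => -[].
rewrite sumEFin; congr (_%:E).
rewrite -(pair_big xpredT xpredT
  (fun k l => \sum_i \sum_j h (i, j) * draws_law k l i j)) /=.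
set D := \sum_i p i * _; set N := enorm (\sum_i _) ^+ 2.
have E k l : \sum_i \sum_j h (i, j) * draws_law k l i j =
    if k == l then D else N.
  rewrite /draws_law; case: ifP => _.
    apply: eq_bigr => i _; rewrite (bigD1 i) //= eqxx big1 ?addr0.
      by rewrite mulrC enorm_sqr.
    by move=> j ji; rewrite eq_sym (negbTE ji) mulr0.
  rewrite /N enorm_sqr dot_suml; apply: eq_bigr => i _.
  by rewrite dot_sumr; apply: eq_bigr => j _; rewrite dotZl dotZr mulrC mulrA.
transitivity (\sum_(k < tau) \sum_(l < tau) (N + if l == k then D - N else 0)).
  apply: eq_bigr => k _; apply: eq_bigr => l _; rewrite E eq_sym.
  by case: ifP => _; rewrite ?addr0 // addrC subrK.
under eq_bigr => k _ do
  rewrite big_split /= -big_mkcond big_pred1_eq sumr_const card_ord.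
by rewrite sumr_const card_ord; ring.
Qed.

End Draws.

(** * Second moment of the sketched gradient difference *)

(** The closed form of the second moment of the sketched gradient difference,
see [expectation_sketched_gradient_diff]. *)
Definition sketch_second_moment (R : realType) (d n tau : nat)
    (p : 'I_n -> R) (fs : 'I_n -> 'cV[R]_d -> R) (x y : 'cV[R]_d) : R :=
  (n%:R * tau%:R)^-1 * (n%:R^-1 *
    \sum_i (p i)^-1 * enorm (gradient (fs i) x - gradient (fs i) y) ^+ 2)
  + (1 - tau%:R^-1) *
    enorm (gradient (average fs) x - gradient (average fs) y) ^+ 2.

Section Sketch.
Context {R : realType} {disp : measure_display} {Omega : measurableType disp}.
Context {n tau d : nat}.
Variables (p : 'I_n -> R) (S : 'I_tau -> Omega -> 'I_n).
Variable fs : 'I_n -> 'cV[R]_d -> R.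

Lemma sketched_gradient_diffE x xs w :
  sketched_gradient_diff p S fs x xs w =
  \sum_k (n%:R * (tau%:R * p (S k w)))^-1 *:
    (gradient (fs (S k w)) x - gradient (fs (S k w)) xs).
Proof.
apply/matrixP => j z; rewrite (ord1 z) {z} /sketched_gradient_diff.
rewrite mxE mxE summxE.
rewrite (eq_bigr (fun i => \sum_k if S k w == i then
   (tau%:R * p i)^-1 * (gradient (fs i) x - gradient (fs i) xs) j ord0
   else 0)); last first.
  move=> i _; rewrite !mul_mx_diag !mxE mulr1 -big_mkcond /= sumr_const.
  by rewrite cardsE mulr_natr; congr (_ *+ _); rewrite mulrC.
rewrite exchange_big mulr_sumr; apply: eq_bigr => k _ /=.
rewrite (bigD1 (S k w)) //= eqxx big1 ?addr0; last first.
  by move=> i; rewrite eq_sym => /negbTE ->.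
by rewrite [RHS]mxE [in RHS]invfM mulrA.
Qed.

Hypotheses (n_gt0 : (0 < n)%N) (tau_gt0 : (0 < tau)%N).
Hypothesis p_gt0 : forall i, 0 < p i.
Hypothesis fs_diff : forall i x, differentiable (fs i) x.
Variable P : probability Omega R.
Hypothesis S_sampling : sampling_with_replacement P p S.

Let n_neq0 : n%:R != 0 :> R. Proof. by rewrite pnatr_eq0 -lt0n. Qed.
Let tau_neq0 : tau%:R != 0 :> R. Proof. by rewrite pnatr_eq0 -lt0n. Qed.

Lemma expectation_sketched_gradient_diff x y :
  ('E_P[fun w => (enorm (sketched_gradient_diff p S fs x y w) ^+ 2)%R] =
   (sketch_second_moment tau p fs x y)%:E)%E.
Proof.
pose g i := gradient (fs i) x - gradient (fs i) y.
pose a i := (n%:R * (tau%:R * p i))^-1 *: g i.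
rewrite (_ : (fun w => _) = (fun w => enorm (\sum_k a (S k w)) ^+ 2));
  last first.
  by apply/funext => w; rewrite sketched_gradient_diffE.
rewrite (expectation_sqr_sum_draws S_sampling) /sketch_second_moment.
congr (_ %:E).
have p_neq0 i : p i != 0 by rewrite gt_eqF.
congr (_ + _).
  rewrite !mulr_sumr; apply: eq_bigr => i _.
  rewrite /a enormZ exprMn -normrX ger0_norm ?sqr_ge0 //.
  have := p_neq0 i; rewrite /g; move: n_neq0 tau_neq0.
  set e := enorm _ ^+ 2 => n0 t0 p0.
  by field; rewrite n0 t0 p0.
have -> : \sum_i p i *: a i =
    tau%:R^-1 *: (gradient (average fs) x - gradient (average fs) y).
  rewrite !gradient_average; try by move=> i; exact: fs_diff.
  rewrite -scalerBr -sumrB scalerA scaler_sumr; apply: eq_bigr => i _.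
  rewrite /a scalerA; congr (_ *: _).
  by move: n_neq0 tau_neq0 (p_neq0 i) => n0 t0 p0; field; rewrite n0 t0 p0.
rewrite enormZ exprMn -normrX ger0_norm ?sqr_ge0 //.
by move: tau_neq0 => t0; field.
Qed.

End Sketch.

(** * The least expected smoothness constant *)

(** The least constant exists as the set of admissible ones is closed under
infima; where [B x] vanishes, [V x <= 0] because [C] is admissible. *)
Lemma ex_least_multiplier (R : realType) (T : Type) (V B : T -> R) (C : R) :
  0 <= C -> (forall x, 0 <= B x) -> (forall x, V x <= C * B x) ->
  exists c : R, [/\ 0 <= c, forall x, V x <= c * B x, c <= C &
    forall c', 0 <= c' -> (forall x, V x <= c' * B x) -> c <= c'].
Proof.
move=> C0 B0 VC.
pose A : set R := [set c | 0 <= c /\ forall x, V x <= c * B x].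
have AC : A C by [].
have lbA : lbound A 0 by move=> c [].
have A0 : A !=set0 by exists C.
exists (inf A); split.
- exact: lb_le_inf.
- move=> x; have [Bx0|Bx] := eqVneq (B x) 0.
    by have := VC x; rewrite Bx0 !mulr0.
  have Bp : 0 < B x by rewrite lt_neqAle eq_sym Bx B0.
  rewrite -ler_pdivrMr //; apply: lb_le_inf => // c [_ Vc].
  by rewrite ler_pdivrMr.
- by apply: ge_inf => //; exists 0.
- by move=> c' c'0 Vc'; apply: ge_inf; [exists 0|split].
Qed.

Section Bound.
Context {R : realType} {d n : nat}.
Variables (tau : nat) (p : 'I_n -> R) (fs : 'I_n -> 'cV[R]_d -> R)
  (L : 'I_n -> R) (Lf : R).
Hypotheses (tau_gt0 : (0 < tau)%N) (p_gt0 : forall i, 0 < p i).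
Hypotheses (fs_smooth : forall i, L_smooth (L i) (fs i))
  (fs_convex : forall i, convex (fs i))
  (f_smooth : L_smooth Lf (average fs)) (f_convex : convex (average fs)).

Let onem_ge0 : 0 <= 1 - tau%:R^-1 :> R.
Proof. by rewrite subr_ge0 invf_le1 ?ler1n ?ltr0n. Qed.
Let M := \big[Num.max/0]_(i < n) (L i / p i).
Let le_M i : L i / p i <= M. Proof. by rewrite /M; apply: le_bigmax. Qed.
Let M_ge0 : 0 <= M. Proof. exact: bigmax_ge_id. Qed.

Let C := (1 - tau%:R^-1) * Lf + (n%:R * tau%:R)^-1 * M.

Lemma smoothness_bound_ge0 : 0 <= C.
Proof.
have [Lf0 _ _] := f_smooth.
by rewrite addr_ge0 // mulr_ge0 // invr_ge0 mulr_ge0 // ler0n.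
Qed.

Lemma sketch_second_moment_le x y :
  sketch_second_moment tau p fs x y <= 2 * C * bregman (average fs) x y.
Proof.
have bavg : bregman (average fs) x y = n%:R^-1 * \sum_i bregman (fs i) x y.
  by apply: bregman_average => i; have [_ df _] := fs_smooth i.
have B0 i : 0 <= bregman (fs i) x y.
  by apply: bregman_ge0 => //; have [_ df _] := fs_smooth i.
have -> : 2 * C * bregman (average fs) x y =
    (n%:R * tau%:R)^-1 * (n%:R^-1 * \sum_i 2 * M * bregman (fs i) x y)
  + (1 - tau%:R^-1) * (2 * Lf * bregman (average fs) x y).
  by rewrite -mulr_sumr bavg /C; ring.
apply: lerD; last by rewrite ler_wpM2l // sqr_gradient_le_bregman.
rewrite ler_wpM2l ?invr_ge0 ?mulr_ge0 ?ler0n // ler_wpM2l ?invr_ge0 ?ler0n //.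
apply: ler_sum => i _.
apply: (@le_trans _ _ ((p i)^-1 * (2 * L i * bregman (fs i) x y))).
  by rewrite ler_wpM2l ?invr_ge0 ?(ltW (p_gt0 i)) // sqr_gradient_le_bregman.
have -> : (p i)^-1 * (2 * L i * bregman (fs i) x y) =
  2 * (L i / p i) * bregman (fs i) x y by ring.
by rewrite ler_wpM2r // ler_wpM2l.
Qed.

End Bound.

(* Since p i > 0 and L i >= 0, the big maximum with unit 0 is the maximum over
   the nonempty index set. *)
Theorem lemmaF6 (R : realType) (d n tau : nat)
    (disp : measure_display) (Omega : measurableType disp)
    (P : probability Omega R)
    (p : 'I_n -> R) (S : 'I_tau -> Omega -> 'I_n)
    (fs : 'I_n -> 'cV[R]_d -> R) (L : 'I_n -> R) (Lf : R)
    (psi : 'cV[R]_d -> \bar R) (xs : 'cV[R]_d)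
    (tau_ge1 : (1 <= tau)%N)
    (p_gt0 : forall i, 0 < p i)
    (p_sum1 : \sum_i p i = 1)
    (S_sampling : sampling_with_replacement P p S)
    (fs_smooth : forall i, L_smooth (L i) (fs i))
    (fs_convex : forall i, convex (fs i))
    (f_smooth : L_smooth Lf (average fs))
    (f_convex : convex (average fs))
    (psi_pcc : proper_closed_convex psi)
    (xs_min : is_minimizer (average fs) psi xs) :
  exists L1 : R,
    is_expected_smoothness_constant P p S fs xs L1 /\
    L1 <= (1 - tau%:R^-1) * Lf
          + (n%:R * tau%:R)^-1 * \big[Num.max/0]_(i < n) (L i / p i).
Proof.
have n_gt0 : (0 < n)%N.
  (* The probabilities over an empty index set would sum to 0. *)
  case: n p p_sum1 {S S_sampling fs fs_smooth fs_convex f_smooth f_convex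
    xs_min L p_gt0} => // q.
  by rewrite big_ord0 => /eqP; rewrite eq_sym oner_eq0.
have fs_diff i x : differentiable (fs i) x by have [_ df _] := fs_smooth i.
have f_diff : differentiable (average fs) xs by have [_ df _] := f_smooth.
have VC x : sketch_second_moment tau p fs x xs <=
    ((1 - tau%:R^-1) * Lf
     + (n%:R * tau%:R)^-1 * \big[Num.max/0]_(i < n) (L i / p i)) *
    (2 * bregman (average fs) x xs).
  by rewrite mulrCA mulrA; exact: sketch_second_moment_le.
have B0 x : 0 <= 2 * bregman (average fs) x xs.
  by rewrite mulr_ge0 // bregman_ge0.
have [c [c0 Vc cC cmin]] :=
  ex_least_multiplier (smoothness_bound_ge0 p L tau_ge1 f_smooth) B0 VC.
exists c; split => //; split => [|c' [c'0 Vc']].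
  split => // x; rewrite expectation_sketched_gradient_diff // lee_fin.
  by rewrite (mulrC 2) -mulrA; exact: Vc.
apply: cmin => // x; have := Vc' x.
by rewrite expectation_sketched_gradient_diff // lee_fin (mulrC 2) -mulrA.
Qed.
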